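(* Let $ABC$ be a nondegenerate triangle with $a=|BC|$, $b=|CA|$, $c=|AB|$ and angles $A,B,C$, and let $x,y,z$ be real numbers with $\frac xa+\frac yb+\frac zc\neq 0$. Let $P,Q$ be the points with barycentric coordinates $$P=\left(\tfrac xa+\tfrac yb+\tfrac zc\right)^{-1}\left[\tfrac yb,\ \tfrac zc,\ \tfrac xa\right],\qquad Q=\left(\tfrac xa+\tfrac yb+\tfrac zc\right)^{-1}\left[\tfrac zc,\ \tfrac xa,\ \tfrac yb\right].$$ Then $$x^2+y^2+z^2-2yz\cos A-2zx\cos B-2xy\cos C=\left(\tfrac xa+\tfrac yb+\tfrac zc\right)^2|PQ|^2\ \ge\ 0 .$$
   Context: Barycentric coordinates are taken with respect to triangle $ABC$ and normalized: $[u,v,w]$ with $u+v+w=1$ denotes the point $uA+vB+wC$ (affine combination of the vertices). *)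

(* Defs.v *)
From mathcomp Require Import all_boot all_order all_algebra.
From mathcomp Require Import all_classical all_reals all_analysis.

Set Implicit Arguments.
Unset Strict Implicit.
Unset Printing Implicit Defensive.

Import Order.TTheory GRing.Theory Num.Theory.
Local Open Scope ring_scope.

Definition eucl_dot (R : realType) (u v : 'rV[R]_2) : R := \sum_(i < 2) u 0 i * v 0 i.

(* The library norm `|u| on row vectors is the sup norm, not the Euclidean
   one, so Euclidean length is defined here. *)
Definition eucl_norm (R : realType) (u : 'rV[R]_2) : R := Num.sqrt (eucl_dot u u).

Definition eucl_dist (R : realType) (X Y : 'rV[R]_2) : R := eucl_norm (X - Y).

(* Unoriented angle XYZ, with vertex Y, in [0, pi]; it is meaningful only if
   X != Y and Z != Y. *)
Definition angle (R : realType) (X Y Z : 'rV[R]_2) : R :=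
  acos (eucl_dot (X - Y) (Z - Y) / (eucl_norm (X - Y) * eucl_norm (Z - Y))).

(* A, B, C are affinely independent. *)
Definition nondegenerate_triangle (R : realType) (A B C : 'rV[R]_2) : bool :=
  row_free (col_mx (B - A) (C - A)).

(* Point with normalized barycentric coordinates [u, v, w] with respect to
   ABC; meant for u + v + w = 1. *)
Definition bary (R : realType) (A B C : 'rV[R]_2) (u v w : R) : 'rV[R]_2 :=
  u *: A + v *: B + w *: C.

(* Main.v *)
Require Import Defs.
From mathcomp Require Import all_boot all_order all_algebra.
From mathcomp Require Import all_classical all_reals all_analysis.
From mathcomp Require Import ring.

Import Order.TTheory GRing.Theory Num.Theory.
Local Open Scope ring_scope.

(* With X = x/a, Y = y/b, Z = z/c and s = X + Y + Z, one has
   s (P - Q) = X (C - B) + Y (A - C) + Z (B - A), a combination with weights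
   x, y, z of unit vectors along the oriented sides.  The pairwise inner
   products of these unit vectors are - cos gamma, - cos alpha, - cos beta. *)

Lemma eucl_dotE (R : realType) (u v : 'rV[R]_2) :
  eucl_dot u v = u 0 0 * v 0 0 + u 0 1 * v 0 1.
Proof.
rewrite /eucl_dot !big_ord_recl big_ord0 addr0.
by congr (_ + u _ _ * v _ _); apply/val_inj.
Qed.

Lemma eucl_dot_ge0 (R : realType) (u : 'rV[R]_2) : 0 <= eucl_dot u u.
Proof. by rewrite eucl_dotE -!expr2 addr_ge0 ?sqr_ge0. Qed.

Lemma sqr_eucl_norm (R : realType) (u : 'rV[R]_2) :
  eucl_norm u ^+ 2 = eucl_dot u u.
Proof. by rewrite sqr_sqrtr ?eucl_dot_ge0. Qed.

Lemma eucl_norm_gt0 (R : realType) (u : 'rV[R]_2) : u != 0 -> 0 < eucl_norm u.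
Proof.
move=> u_neq0; rewrite sqrtr_gt0 lt_neqAle eucl_dot_ge0 andbT eq_sym.
apply: contraNneq u_neq0; rewrite eucl_dotE -!expr2 => /eqP.
rewrite paddr_eq0 ?sqr_ge0 // !sqrf_eq0 => /andP[/eqP u0 /eqP u1].
apply/eqP/rowP => i; rewrite mxE; case: i => [[|[|//]] lti].
  by rewrite -[RHS]u0; congr (u _ _); apply/val_inj.
by rewrite -[RHS]u1; congr (u _ _); apply/val_inj.
Qed.

Lemma eucl_distC (R : realType) (X Y : 'rV[R]_2) : eucl_dist X Y = eucl_dist Y X.
Proof. by rewrite /eucl_dist /eucl_norm !eucl_dotE !mxE; congr Num.sqrt; ring. Qed.

(** Lagrange's identity in the plane: after squaring, the right side minus the left side is the
    square of the determinant of [u] and [v]. *)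
Lemma eucl_cauchy_schwarz (R : realType) (u v : 'rV[R]_2) :
  `|eucl_dot u v| <= eucl_norm u * eucl_norm v.
Proof.
rewrite -ler_sqr ?nnegrE ?mulr_ge0 ?sqrtr_ge0 // exprMn !sqr_eucl_norm.
rewrite real_normK ?num_real // !eucl_dotE -subr_ge0.
by rewrite [leRHS](_ : _ = (u 0 0 * v 0 1 - u 0 1 * v 0 0) ^+ 2) ?sqr_ge0 //; ring.
Qed.

(** Cauchy-Schwarz puts the quotient inside [acos] in [-1, 1], where [cos] inverts [acos]; the
    denominator is positive and cancels. *)
Lemma cos_angle (R : realType) (X Y Z : 'rV[R]_2) : X != Y -> Z != Y ->
  eucl_dist X Y * eucl_dist Z Y * cos (angle X Y Z) = eucl_dot (X - Y) (Z - Y).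
Proof.
rewrite -subr_eq0 -[Z == Y]subr_eq0 => /eucl_norm_gt0 X0 /eucl_norm_gt0 Z0.
have XZ0 := mulr_gt0 X0 Z0.
rewrite acosK; first by rewrite mulrC divfK ?gt_eqF.
rewrite in_itv /= -ler_norml normrM normfV (gtr0_norm XZ0) ler_pdivrMr // mul1r.
exact: eucl_cauchy_schwarz.
Qed.

Lemma nondegenerate_triangle_neq (R : realType) (A B C : 'rV[R]_2) :
  nondegenerate_triangle A B C -> [/\ B != A, C != A & C != B].
Proof.
move=> /row_free_inj free.
have free2 (s t : R) : s *: (B - A) + t *: (C - A) = 0 -> s = 0 /\ t = 0.
  move=> st0.
  (* The combination is the image of the row (s, t) under the matrix with rows [B - A] and [C - A],
     so injectivity forces (s, t) = 0. *)
  have /free : row_mx s%:M t%:M *m col_mx (B - A) (C - A)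
               = (row_mx 0 0 : 'rV_(1 + 1)) *m col_mx (B - A) (C - A).
    by rewrite !mul_row_col !mul_scalar_mx !mul0mx addr0.
  move=> /eq_row_mx[/matrixP/(_ 0 0) + /matrixP/(_ 0 0)].
  by rewrite !mxE !mulr1n.
(* Each coincidence of two vertices yields a nontrivial relation between [B - A] and [C - A]; the
   last one, C = B, makes their difference vanish. *)
split; apply/eqP => e.
- have [] := free2 1 0; last by move=> /eqP; rewrite oner_eq0.
  by rewrite e subrr scaler0 scale0r addr0.
- have [] := free2 0 1; last by move=> _ /eqP; rewrite oner_eq0.
  by rewrite e subrr scaler0 scale0r addr0.
- have [] := free2 1 (-1); last by move=> /eqP; rewrite oner_eq0.
  by rewrite e scale1r scaleN1r subrr.
Qed.

(** Expands the squared norm of X (C - B) + Y (A - C) + Z (B - A). Consecutive oriented sides meet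
    head to tail, so each cross term is minus the inner product of the two sides leaving their
    common vertex. *)
Lemma eucl_dist_bary_shift (R : realType) (A B C : 'rV[R]_2) (s X Y Z : R) :
  s != 0 ->
  s ^+ 2 * eucl_dist (bary A B C (s^-1 * Y) (s^-1 * Z) (s^-1 * X))
                     (bary A B C (s^-1 * Z) (s^-1 * X) (s^-1 * Y)) ^+ 2
  = X ^+ 2 * eucl_dist B C ^+ 2 + Y ^+ 2 * eucl_dist C A ^+ 2
    + Z ^+ 2 * eucl_dist A B ^+ 2
    - 2 * Y * Z * eucl_dot (B - A) (C - A)
    - 2 * Z * X * eucl_dot (C - B) (A - B)
    - 2 * X * Y * eucl_dot (A - C) (B - C).
Proof.
by move=> s0; rewrite /eucl_dist !sqr_eucl_norm !eucl_dotE !mxE; field.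
Qed.

Theorem mainTheorem4 (R : realType) (A B C : 'rV[R]_2)
    (hABC : nondegenerate_triangle A B C)
    (a b c : R) (ha : a = eucl_dist B C) (hb : b = eucl_dist C A) (hc : c = eucl_dist A B)
    (alpha beta gamma : R) (halpha : alpha = angle B A C)
    (hbeta : beta = angle C B A) (hgamma : gamma = angle A C B)
    (x y z : R) (hs : x / a + y / b + z / c != 0)
    (P Q : 'rV[R]_2)
    (hP : P = bary A B C ((x / a + y / b + z / c)^-1 * (y / b))
                         ((x / a + y / b + z / c)^-1 * (z / c))
                         ((x / a + y / b + z / c)^-1 * (x / a)))
    (hQ : Q = bary A B C ((x / a + y / b + z / c)^-1 * (z / c))
                         ((x / a + y / b + z / c)^-1 * (x / a))
                         ((x / a + y / b + z / c)^-1 * (y / b))) :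
  x ^+ 2 + y ^+ 2 + z ^+ 2 - 2 * y * z * cos alpha - 2 * z * x * cos beta
      - 2 * x * y * cos gamma
    = (x / a + y / b + z / c) ^+ 2 * eucl_dist P Q ^+ 2
  /\ 0 <= (x / a + y / b + z / c) ^+ 2 * eucl_dist P Q ^+ 2.
Proof.
split; last by rewrite mulr_ge0 ?sqr_ge0.
have [BA CA CB] := nondegenerate_triangle_neq _ _ _ _ hABC.
have [AB AC BC] : [/\ A != B, A != C & B != C] by split; rewrite eq_sym.
have side_neq0 (X Y : 'rV[R]_2) : X != Y -> eucl_dist X Y != 0.
  by rewrite -subr_eq0 => /eucl_norm_gt0 h; rewrite gt_eqF.
have a0 : a != 0 by rewrite ha side_neq0.
have b0 : b != 0 by rewrite hb side_neq0.
have c0 : c != 0 by rewrite hc side_neq0.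
(* The side lengths are named cyclically, whereas [cos_angle] measures both sides toward the vertex
   of the angle; in each of the three cases one distance has to be reversed. *)
have cosA : c * b * cos alpha = eucl_dot (B - A) (C - A).
  by rewrite -cos_angle // halpha hc hb (eucl_distC _ A B).
have cosB : a * c * cos beta = eucl_dot (C - B) (A - B).
  by rewrite -cos_angle // hbeta ha hc (eucl_distC _ B C).
have cosC : b * a * cos gamma = eucl_dot (A - C) (B - C).
  by rewrite -cos_angle // hgamma hb ha (eucl_distC _ C A).
rewrite hP hQ eucl_dist_bary_shift // -ha -hb -hc -cosA -cosB -cosC.
(* The side lengths cancel: (x/a)^2 a^2 = x^2, and (y/b) (z/c) (c b cos alpha) = y z cos alpha,
   likewise for the other terms. *)
by field; rewrite a0 b0 c0.
Qed.
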